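(* Let $J$ be a bounded Jacobi matrix with $a_j>0$ and $b_j\in\mathbb{C}$ for all $j\ge0$, with spectral data $\Lambda(J)=(\nu,\psi)$. Let $q_j(s)$, $j\ge0$, be the polynomials in the real variable $s$ with complex coefficients defined by $q_0=1$ and $$b_0q_0(s)+a_0q_1(s)=s\,\overline{q_0(s)},\qquad a_{j-1}q_{j-1}(s)+b_jq_j(s)+a_jq_{j+1}(s)=s\,\overline{q_j(s)},\quad j\ge1 .$$ Then for all $j,k\ge0$ we have the orthogonality relation $$\frac12\int_0^\infty\left\langle\begin{pmatrix}1+\operatorname{Re}\psi(s)&-\mathrm{i}\operatorname{Im}\psi(s)\\ \mathrm{i}\operatorname{Im}\psi(s)&1-\operatorname{Re}\psi(s)\end{pmatrix}\begin{pmatrix}q_j(s)\\ {q_j(-s)}\end{pmatrix},\begin{pmatrix}q_k(s)\\ {q_k(-s)}\end{pmatrix}\right\rangle_{\mathbb{C}^2}\mathrm{d}\nu(s)=\delta_{j,k},$$ or alternatively $$\int_0^\infty\left\langle\begin{pmatrix}1&\psi(s)\\ \overline{\psi(s)}&1\end{pmatrix}\begin{pmatrix}q_j^{\mathrm e}(s)\\ {q_j^{\mathrm o}(s)}\end{pmatrix},\begin{pmatrix}q_k^{\mathrm e}(s)\\ {q_k^{\mathrm o}(s)}\end{pmatrix}\right\rangle_{\mathbb{C}^2}\mathrm{d}\nu(s)=\delta_{j,k},$$ where $$q_j^{\mathrm e}(s):=\frac{q_j(s)+q_j(-s)}{2},\qquad q_j^{\mathrm o}(s):=\frac{q_j(s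)-q_j(-s)}{2}.$$
   Context: Let $\delta_j$, $j\ge0$, be the standard basis of $\ell^2(\mathbb{N}_0)$, $\mathbb{N}_0=\{0,1,2,\dots\}$. All inner products (in $\ell^2(\mathbb{N}_0)$ and $\mathbb{C}^2$) are linear in the first argument and antilinear in the second; $\delta_{j,k}$ is the Kronecker delta. A Jacobi matrix with parameters $(a_j)_{j\ge0}$, $(b_j)_{j\ge0}$ is the infinite tridiagonal symmetric matrix $J$ with $J_{j,j}=b_j$, $J_{j,j+1}=J_{j+1,j}=a_j$ and all other entries zero. It is bounded if $\sup_{j\ge0}(|a_j|+|b_j|)<\infty$; it is then regarded as a bounded linear operator on $\ell^2(\mathbb{N}_0)$. We write $|J|=\sqrt{J^*J}$. The spectral data of $J$ is the pair $\Lambda(J)=(\nu,\psi)$, where $\nu(\Delta)=\langle\chi_\Delta(|J|)\delta_0,\delta_0\rangle$ is the spectral measure of $|J|$ corresponding to $\delta_0$ (a Borel probability measure with bounded support in $[0,\infty)$), and $\psi$ is the unique element of $L^\infty(\nu)$ with $\psi(0)=1$, $|\psi(s)|\le1$ for $\nu$-a.e. $s\ge0$, and $\langle Jf(|J|)\delta_0,\delta_0\rangle=\int_0^\infty s f(s)\psi(s)\,\mathrm{d}\nu(s)$ for all $f\in C(\mathbb{R})$. *)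

(* Defs.v *)
From HB Require Import structures.
From mathcomp Require Import all_boot all_order all_algebra.
From mathcomp Require Import ring lra.
From mathcomp Require Import complex.
From mathcomp Require Import all_classical all_reals all_analysis.

Set Implicit Arguments.
Unset Strict Implicit.
Unset Printing Implicit Defensive.

Import Order.TTheory GRing.Theory Num.Theory.
Import numFieldNormedType.Exports.

Local Open Scope classical_set_scope.
Local Open Scope ring_scope.
Local Open Scope complex_scope.

(* The modulus with values in R; the generic norm of R[i] takes values in R[i]. *)
Notation cabs := ComplexField.Normc.normc.

Section SquareSummable.
Variable R : realType.
Local Notation C := R[i].

Definition sqr_summable (x : nat -> C) : Prop :=
  cvgn (series (fun n => cabs (x n) ^+ 2)).

Definition l2_pred : {pred (nat -> C)} := fun x => `[< sqr_summable x >].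

Lemma sqr_cabs (z : C) : cabs z ^+ 2 = complex.Re z ^+ 2 + complex.Im z ^+ 2.
Proof. by case: z => u v /=; rewrite sqr_sqrtr ?addr_ge0 ?sqr_ge0. Qed.

Lemma sqr_cabsD (z w : C) :
  cabs (z + w) ^+ 2 <= 2 * cabs z ^+ 2 + 2 * cabs w ^+ 2.
Proof.
rewrite !sqr_cabs; case: z w => [u v] [w z] /=; rewrite -subr_ge0.
have -> : 2 * (u ^+ 2 + v ^+ 2) + 2 * (w ^+ 2 + z ^+ 2) -
  ((u + w) ^+ 2 + (v + z) ^+ 2) = (u - w) ^+ 2 + (v - z) ^+ 2 by ring.
by rewrite addr_ge0 ?sqr_ge0.
Qed.

Fact l2_submod_closed : submod_closed l2_pred.
Proof.
split.
  apply/asboolP; rewrite /sqr_summable.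
  have -> : series (fun n => cabs ((0 : nat -> C) n) ^+ 2) = fun=> 0.
    apply/funext => n; apply: big1 => i _.
    by rewrite sqr_cabs /= expr0n /= addr0.
  exact: is_cvg_cst.
move=> c x y /asboolP cx /asboolP cy; apply/asboolP.
rewrite /sqr_summable in cx cy *.
have cv : cvgn (series ((fun n => (2 * cabs c ^+ 2) * cabs (x n) ^+ 2)
   \+ (fun n => 2 * cabs (y n) ^+ 2))).
  apply: is_cvg_seriesD; first exact: (@is_cvg_seriesZ _ (fun n => cabs (x n) ^+ 2)).
  exact: (@is_cvg_seriesZ _ (fun n => cabs (y n) ^+ 2)).
apply: (series_le_cvg _ _ _ cv) => n; first by rewrite sqr_ge0.
  by apply: addr_ge0; do ?[exact: sqr_ge0 | exact: ler0n | apply: mulr_ge0].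
apply: le_trans (sqr_cabsD (c * x n) (y n)) _.
by rewrite ComplexField.Normc.normcM exprMn mulrA.
Qed.

HB.instance Definition _ := GRing.isSubmodClosed.Build C (nat -> C) l2_pred
  l2_submod_closed.

End SquareSummable.

Record l2 (R : realType) := L2 {
  l2_val :> nat -> R[i];
  l2_valP : l2_val \in @l2_pred R }.

Section L2Instances.
Variable R : realType.
HB.instance Definition _ := [isSub for @l2_val R].
HB.instance Definition _ := [Choice of l2 R by <:].
HB.instance Definition _ := [SubChoice_isSubLmodule of l2 R by <:].
End L2Instances.

Section L2Theory.
Variable R : realType.
Local Notation C := R[i].

Fact delta_subproof (k : nat) : (fun j => (j == k)%:R : C) \in @l2_pred R.
Proof.
apply/asboolP; rewrite /sqr_summable.
apply: (cvgP (1 : R)); apply: cvg_near_cst.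
exists k.+1 => // n /= kn; rewrite /series /=.
rewrite (bigD1_seq k) /= ?mem_index_iota ?iota_uniq //.
rewrite big1 => [|j /negbTE jk].
  by rewrite sqr_cabs eqxx /= expr1n expr0n /= !addr0.
by rewrite sqr_cabs jk /= expr0n /= addr0.
Qed.

Definition delta (k : nat) : l2 R := L2 (delta_subproof k).

Definition csum (u : nat -> C) : C :=
  limn (series (fun n => complex.Re (u n)))
    +i* limn (series (fun n => complex.Im (u n))).

Definition dot (x y : l2 R) : C := csum (fun n => x n * (y n)^*%C).

Definition l2norm (x : l2 R) : R :=
  Num.sqrt (limn (series (fun n => cabs (x n) ^+ 2))).

Record bop := Bop {
  bop_fun :> {linear l2 R -> l2 R};
  bop_bounded : exists M : R, forall x, l2norm (bop_fun x) <= M * l2norm x }.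

Definition is_adjoint (T S : bop) : Prop :=
  forall x y, dot (T x) y = dot x (S y).

(* On C the order is such that 0 <= z means that z is real and nonnegative. *)
Definition positive_op (T : bop) : Prop := forall x, 0 <= dot (T x) x.

(* A is the positive square root of T^* T. *)
Definition is_abs (T A : bop) : Prop :=
  positive_op A /\
  exists2 S : bop, is_adjoint T S & forall x, A (A x) = S (T x).

(* Complex-valued Borel functions on R, bounded on bounded sets. *)
Definition cmeasurable (D : set R) (f : R -> C) : Prop :=
  measurable_fun D (fun s => complex.Re (f s)) /\
  measurable_fun D (fun s => complex.Im (f s)).

Definition locally_bounded (F : set (R -> C)) : Prop :=
  forall r : R, exists M : R, forall f, F f ->
    forall s, `|s| <= r -> cabs (f s) <= M.

Definition borel_lb (f : R -> C) : Prop :=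
  cmeasurable setT f /\ locally_bounded [set f].

Definition ccvg (u : nat -> C) (z : C) : Prop :=
  (fun n => cabs (u n - z)) @ \oo --> (0 : R).

(* Phi f is f(A) for every f in borel_lb, A being a bounded self-adjoint
   operator: these properties determine Phi on borel_lb, and the spectral
   theorem provides it. Since the spectrum of A is bounded, asking for
   boundedness on bounded sets only allows the identity function. *)
Record borel_calculus (A : bop) (Phi : (R -> C) -> bop) : Prop := {
  bc_id : forall x, Phi (fun s => s%:C) x = A x;
  bc_one : forall x, Phi (fun=> 1) x = x;
  bc_linear : forall (c : C) f g x, borel_lb f -> borel_lb g ->
    Phi (fun s => c * f s + g s) x = c *: Phi f x + Phi g x;
  bc_mul : forall f g x, borel_lb f -> borel_lb g ->
    Phi (fun s => f s * g s) x = Phi f (Phi g x);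
  bc_conj : forall f, borel_lb f ->
    is_adjoint (Phi f) (Phi (fun s => (f s)^*%C));
  bc_cvg : forall (f_ : nat -> R -> C) f,
    (forall n, borel_lb (f_ n)) -> borel_lb f ->
    locally_bounded (range f_) ->
    (forall s, ccvg (f_ ^~ s) (f s)) ->
    forall x y, ccvg (fun n => dot (Phi (f_ n) x) y) (dot (Phi f x) y) }.

Definition cindic (D : set R) (s : R) : C := (\1_D s)%:C.

Definition ccontinuous (f : R -> C) : Prop :=
  continuous (fun s => complex.Re (f s)) /\
  continuous (fun s => complex.Im (f s)).

Definition cintegral (mu : {measure set (measurableTypeR R) -> \bar R})
    (D : set R) (f : R -> C) : C :=
  Rintegral mu D (fun s => complex.Re (f s))
    +i* Rintegral mu D (fun s => complex.Im (f s)).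

Definition jacobi_mx (a : nat -> R) (b : nat -> C) (j k : nat) : C :=
  if j == k then b j
  else if k == j.+1 then (a j)%:C
  else if j == k.+1 then (a k)%:C
  else 0.

Definition jacobi_bounded (a : nat -> R) (b : nat -> C) : Prop :=
  exists M : R, forall j, `|a j| + cabs (b j) <= M.

(* T is the operator on l2 with matrix M; the inner product being linear in its
   first argument, <T delta_k, delta_j> is the entry in row j, column k. *)
Definition has_matrix (T : bop) (M : nat -> nat -> C) : Prop :=
  forall j k, dot (T (delta k)) (delta j) = M j k.

(* The class of psi in L^oo(nu) is represented by a Borel function on [0, +oo[
   with psi 0 = 1 pointwise: when nu has no atom at 0 this is a mere choice of
   representative. *)
Definition spectral_data (J : bop) (nu : probability (measurableTypeR R) R)
    (psi : R -> C) : Prop :=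
  exists (A : bop) (Phi : (R -> C) -> bop),
  [/\ is_abs J A, borel_calculus A Phi,
      (forall D : set R, measurable D ->
        (fine (nu D))%:C = dot (Phi (cindic D) (delta 0%N)) (delta 0%N)),
      [/\ cmeasurable `[0, +oo[ psi, psi 0 = 1 &
          {ae nu, forall s, 0 <= s -> cabs (psi s) <= 1}] &
      forall f, ccontinuous f ->
        dot (J (Phi f (delta 0%N))) (delta 0%N) =
          cintegral nu `[0, +oo[ (fun s => s%:C * f s * psi s)].

Definition cvec2 (u v : C) : 'cV[C]_2 := \col_i [:: u; v]`_i.

Definition cmx2 (m00 m01 m10 m11 : C) : 'M[C]_2 :=
  \matrix_(i, j) (nth [::] [:: [:: m00; m01]; [:: m10; m11]] i)`_j.

Definition dot2 (u v : 'cV[C]_2) : C := \sum_(i < 2) u i 0 * (v i 0)^*%C.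

Definition even_part (p : {poly C}) (s : R) : C :=
  (p.[s%:C] + p.[(- s)%:C]) / 2.

Definition odd_part (p : {poly C}) (s : R) : C :=
  (p.[s%:C] - p.[(- s)%:C]) / 2.

End L2Theory.

Arguments bop : clear implicits.

(* Main.v *)
Require Import Defs.
From mathcomp Require Import all_boot all_order all_algebra.
From mathcomp Require Import ring lra.
From mathcomp Require Import complex finmap.
From mathcomp Require Import all_classical all_reals all_analysis.
From mathcomp Require Import measurable_realfun.

(** Let [C] be complex conjugation of sequences and [T = C J], an antilinear
    operator. A Jacobi matrix is symmetric, so [C J C] is the adjoint of [J];
    hence [T^2 = C J C J = J^* J = |J|^2], and [<T x, y> = <T y, x>].

    Conjugating the recurrence of the [q_j] gives the recurrence that [T]
    satisfies on the standard basis,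
    [T delta_j = a_(j-1) delta_(j-1) + conj(b_j) delta_j + a_j delta_(j+1)].
    So [delta_j] is the polynomial with coefficients [conj(q_j)] in [T] applied
    to [delta_0] (lemma [krylov_eval_q]), and [<delta_k, delta_j>] is a
    combination of the numbers [<T^m delta_0, T^n delta_0>].

    By the symmetry of [T], these equal [<T^(m+n) delta_0, delta_0>], conjugated
    when [n] is odd (lemma [dot_krylov]). For even [k], [T^k = |J|^k], and
    [<T^k delta_0, delta_0>] is the [k]-th moment of [nu]. For odd [k],
    [T^k = C J |J|^(k-1)], and the defining property of [psi] makes
    [<T^k delta_0, delta_0>] the conjugate of the integral of [s^k psi(s)].
    Thus [<T^m delta_0, T^n delta_0>] is the integral of [s^(n+m)] against [1],
    [psi] or [conj(psi)] according to the parities of [n] and [m] (lemma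
    [cintegral_weight]). These are the entries of the second matrix weight:
    splitting into even and odd parts sorts the monomials by parity. The first
    weight is the second one in the basis [(e + o, e - o)] (lemma
    [dot2_even_odd]).

    The remaining analysis identifies integrals against [nu] with matrix
    elements of the Borel calculus. This is proved for nonnegative, locally
    bounded functions by monotone approximation with simple functions (lemma
    [dot_bc_ge0]), which also yields the finiteness of all moments. Positivity
    of [|J|] forces [nu] to vanish on the negative half-line (lemma
    [spectral_measure_neg]), so that integrals over the half-line are integrals
    over the whole line. *)

Set Implicit Arguments.
Unset Strict Implicit.
Unset Printing Implicit Defensive.

Import Order.TTheory GRing.Theory Num.Theory.
Import numFieldNormedType.Exports.

Local Open Scope classical_set_scope.
Local Open Scope ring_scope.
Local Open Scope complex_scope.

(** * Real and imaginary parts *)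

Section ComplexParts.
Variable R : realType.
Implicit Types z w : R[i].

Lemma complex_eqP z w :
  complex.Re z = complex.Re w -> complex.Im z = complex.Im w -> z = w.
Proof. by case: z w => u v [u' v'] /= -> ->. Qed.

Lemma cReD z w : complex.Re (z + w) = complex.Re z + complex.Re w.
Proof. by case: z w => [? ?] []. Qed.

Lemma cImD z w : complex.Im (z + w) = complex.Im z + complex.Im w.
Proof. by case: z w => [? ?] []. Qed.

Lemma cReM z w : complex.Re (z * w) =
  complex.Re z * complex.Re w - complex.Im z * complex.Im w.
Proof. by case: z w => [? ?] []. Qed.

Lemma cImM z w : complex.Im (z * w) =
  complex.Re z * complex.Im w + complex.Im z * complex.Re w.
Proof. by case: z w => [? ?] []. Qed.

Lemma cReJ z : complex.Re z^*%C = complex.Re z.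
Proof. by case: z. Qed.

Lemma cImJ z : complex.Im z^*%C = - complex.Im z.
Proof. by case: z. Qed.

Lemma conjcD z w : (z + w)^*%C = z^*%C + w^*%C.
Proof. exact: rmorphD. Qed.

Lemma conjcM z w : (z * w)^*%C = z^*%C * w^*%C.
Proof. exact: rmorphM. Qed.

Lemma cabs_ge0 z : 0 <= cabs z.
Proof. by case: z => u v /=; rewrite sqrtr_ge0. Qed.

Lemma normr_Re_le z : `|complex.Re z| <= cabs z.
Proof.
rewrite -(@ler_pXn2r _ 2) ?nnegrE ?cabs_ge0 // sqr_cabs real_normK ?num_real //.
by rewrite lerDl sqr_ge0.
Qed.

Lemma normr_Im_le z : `|complex.Im z| <= cabs z.
Proof.
rewrite -(@ler_pXn2r _ 2) ?nnegrE ?cabs_ge0 // sqr_cabs real_normK ?num_real //.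
by rewrite lerDr sqr_ge0.
Qed.

Lemma cabsJ z : cabs z^*%C = cabs z.
Proof. by case: z => u v /=; rewrite sqrrN. Qed.

Lemma cabs_real (u : R) : cabs u%:C = `|u|.
Proof. by rewrite /= expr0n /= addr0 sqrtr_sqr. Qed.

End ComplexParts.

(** * The inner product of square summable sequences *)

Section ComplexSeries.
Variable R : realType.
Implicit Types u v : nat -> R[i].

Definition csummable u : Prop :=
  cvgn (series (fun n => complex.Re (u n))) /\
  cvgn (series (fun n => complex.Im (u n))).

Lemma csumZD (c : R[i]) u v : csummable u -> csummable v ->
  csum (fun n => c * u n + v n) = c * csum u + csum v.
Proof.
move=> [uR uI] [vR vI]; apply: complex_eqP.
- rewrite /csum cReD cReM /=.
  have -> : (fun n => complex.Re (c * u n + v n)) =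
    ((fun n => complex.Re c * complex.Re (u n))
    \+ (fun n => - complex.Im c * complex.Im (u n)))
    \+ (fun n => complex.Re (v n)).
    by apply/funext => n /=; rewrite cReD cReM mulNr.
  have s1 := @is_cvg_seriesZ _ (fun n => complex.Re (u n)) (complex.Re c) uR.
  have s2 := @is_cvg_seriesZ _ (fun n => complex.Im (u n)) (- complex.Im c) uI.
  rewrite lim_seriesD //; last exact: is_cvg_seriesD.
  rewrite lim_seriesD // -mulNr; congr (_ + _ + _).
    exact: (@lim_seriesZ _ (fun n => complex.Re (u n))).
  exact: (@lim_seriesZ _ (fun n => complex.Im (u n))).
- rewrite /csum cImD cImM /=.
  have -> : (fun n => complex.Im (c * u n + v n)) =
    ((fun n => complex.Re c * complex.Im (u n))
    \+ (fun n => complex.Im c * complex.Re (u n)))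
    \+ (fun n => complex.Im (v n)).
    by apply/funext => n /=; rewrite cImD cImM.
  have s1 := @is_cvg_seriesZ _ (fun n => complex.Im (u n)) (complex.Re c) uI.
  have s2 := @is_cvg_seriesZ _ (fun n => complex.Re (u n)) (complex.Im c) uR.
  rewrite lim_seriesD //; last exact: is_cvg_seriesD.
  rewrite lim_seriesD //; congr (_ + _ + _).
    exact: (@lim_seriesZ _ (fun n => complex.Im (u n))).
  exact: (@lim_seriesZ _ (fun n => complex.Re (u n))).
Qed.

Lemma csumJ u : csummable u -> csum (fun n => (u n)^*%C) = (csum u)^*%C.
Proof.
move=> [uR uI]; apply: complex_eqP.
  by rewrite cReJ /=; under eq_fun do rewrite cReJ.
rewrite cImJ /=; under eq_fun do rewrite cImJ.
rewrite -(lim_seriesN uI).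
by congr (limn (series _)); apply/funext.
Qed.

Lemma csum_supp1 u k : (forall n, n != k -> u n = 0) -> csum u = u k.
Proof.
move=> u0.
have supp1 (w : nat -> R) : (forall n, n != k -> w n = 0) ->
    limn (series w) = w k.
  move=> w0; apply/cvg_lim => //; apply: cvg_near_cst.
  exists k.+1 => // n /= kn; rewrite /series /=.
  rewrite (bigD1_seq k) /= ?mem_index_iota ?iota_uniq //.
  by rewrite big1 ?addr0 // => j /w0.
by apply: complex_eqP => /=; rewrite supp1 // => n /u0 ->.
Qed.

End ComplexSeries.

Section Dot.
Variable R : realType.
Implicit Types x y z : l2 R.

Lemma l2_sqr_summable x : sqr_summable x.
Proof. by case: x => x hx; apply/asboolP. Qed.

Lemma cabs_mulJ_le (z w : R[i]) :
  cabs (z * w^*%C) <= cabs z ^+ 2 + cabs w ^+ 2.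
Proof.
rewrite ComplexField.Normc.normcM cabsJ.
by have := cabs_ge0 z; have := cabs_ge0 w; nra.
Qed.

(** Domination of [|z w|] by [|z|^2 + |w|^2]. *)
Lemma dot_csummable x y : csummable (fun n => x n * (y n)^*%C).
Proof.
have cv : cvgn (series ((fun n => cabs (x n) ^+ 2)
    \+ (fun n => cabs (y n) ^+ 2))).
  by apply: is_cvg_seriesD; exact: l2_sqr_summable.
have dominated (w : nat -> R) :
    (forall n, `|w n| <= cabs (x n * (y n)^*%C)) -> cvgn (series w).
  move=> hw; apply: normed_cvg; apply: (series_le_cvg _ _ _ cv) => n //=.
    by rewrite addr_ge0 ?sqr_ge0.
  exact: le_trans (hw n) (cabs_mulJ_le _ _).
by split; apply: dominated => n; [exact: normr_Re_le|exact: normr_Im_le].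
Qed.

Lemma dotZD (c : R[i]) x y z : dot (c *: x + y) z = c * dot x z + dot y z.
Proof.
rewrite /dot -csumZD; [|exact: dot_csummable|exact: dot_csummable].
by congr csum; apply/funext => n; rewrite /= mulrDl mulrA.
Qed.

Lemma dotJ x y : (dot x y)^*%C = dot y x.
Proof.
rewrite /dot -csumJ; last exact: dot_csummable.
by congr csum; apply/funext => n; rewrite conjcM conjcK mulrC.
Qed.

Lemma dotDl x y z : dot (x + y) z = dot x z + dot y z.
Proof. by have := dotZD 1 x y z; rewrite scale1r mul1r. Qed.

Lemma dot0l z : dot 0 z = 0.
Proof. by apply: (addIr (dot 0 z)); rewrite -dotDl !add0r. Qed.

Lemma dotZl c x z : dot (c *: x) z = c * dot x z.
Proof. by rewrite -[c *: x]addr0 dotZD dot0l addr0. Qed.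

Lemma dotZr c x z : dot z (c *: x) = c^*%C * dot z x.
Proof. by rewrite -dotJ dotZl conjcM !dotJ. Qed.

Lemma dot_suml I (r : seq I) (F : I -> l2 R) z :
  dot (\sum_(i <- r) F i) z = \sum_(i <- r) dot (F i) z.
Proof. by apply: (big_morph (fun x => dot x z)) => [x y|]; rewrite ?dotDl ?dot0l. Qed.

Lemma dot_sumr I (r : seq I) (F : I -> l2 R) z :
  dot z (\sum_(i <- r) F i) = \sum_(i <- r) dot z (F i).
Proof.
rewrite -dotJ dot_suml (big_morph (@conjc R) (@conjcD R) (@conjc0 R)).
by apply: eq_bigr => i _; rewrite dotJ.
Qed.

Lemma dot_delta x k : dot x (delta R k) = x k.
Proof.
rewrite /dot (@csum_supp1 _ _ k) => [|n /negbTE nk] /=.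
  by rewrite eqxx conjc1 mulr1.
by rewrite nk conjc0 mulr0.
Qed.

Lemma l2_ext x y : (forall n, x n = y n) -> x = y.
Proof. by move=> xy; apply: val_inj; apply/funext. Qed.

Lemma l2_valD x y n : (x + y) n = x n + y n.
Proof. by []. Qed.

Lemma l2_valZ (c : R[i]) x n : (c *: x) n = c * x n.
Proof. by []. Qed.

Lemma delta_val k n : delta R k n = (n == k)%:R.
Proof. by []. Qed.

Fact l2conj_subproof x : (fun n => (x n)^*%C) \in @l2_pred R.
Proof.
apply/asboolP; rewrite /sqr_summable; under eq_fun do rewrite cabsJ.
exact: l2_sqr_summable.
Qed.

Definition l2conj x : l2 R := L2 (l2conj_subproof x).

Lemma l2conjK x : l2conj (l2conj x) = x.
Proof. by apply: l2_ext => n /=; rewrite conjcK. Qed.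

Lemma l2conjZD c x y : l2conj (c *: x + y) = c^*%C *: l2conj x + l2conj y.
Proof. by apply: l2_ext => n /=; rewrite conjcD conjcM. Qed.

Lemma l2conj_delta k : l2conj (delta R k) = delta R k.
Proof. by apply: l2_ext => n /=; rewrite conjc_nat. Qed.

Lemma dot_l2conj x y : dot (l2conj x) y = (dot x (l2conj y))^*%C.
Proof.
rewrite dotJ /dot; congr csum; apply/funext => n /=.
by rewrite mulrC.
Qed.

End Dot.

(** * The antilinear operator attached to a symmetric operator *)

Section AntilinearJacobi.
Variables (R : realType) (J : bop R).
Implicit Types x y : l2 R.

Definition ajac x : l2 R := l2conj (J x).

Lemma ajacZD c x y : ajac (c *: x + y) = c^*%C *: ajac x + ajac y.
Proof. by rewrite /ajac linearP l2conjZD. Qed.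

Lemma ajacD x y : ajac (x + y) = ajac x + ajac y.
Proof. by rewrite -[x]scale1r ajacZD conjc1 !scale1r. Qed.

Lemma ajac0 : ajac 0 = 0.
Proof. by apply: (addIr (ajac 0)); rewrite -ajacD !add0r. Qed.

Lemma ajacZ c x : ajac (c *: x) = c^*%C *: ajac x.
Proof. by rewrite -[c *: x]addr0 ajacZD ajac0 addr0. Qed.

Lemma ajac_val x n : ajac x n = (dot (J x) (delta R n))^*%C.
Proof. by rewrite dot_delta. Qed.

Definition symmetric_matrix : Prop := forall j k,
  dot (J (delta R k)) (delta R j) = dot (J (delta R j)) (delta R k).

Hypothesis Jsym : symmetric_matrix.
Variable S : bop R.
Hypothesis JS : is_adjoint J S.

Lemma adjoint_delta k : S (delta R k) = ajac (delta R k).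
Proof.
apply: l2_ext => n; rewrite -!dot_delta.
by rewrite -dotJ -JS Jsym dot_l2conj l2conj_delta.
Qed.

(** The coordinates of [S x] are inner products of [x] with vectors
    [J (delta n)], and those are the conjugates of the vectors [S (delta n)]. *)
Lemma adjointE x : S x = l2conj (J (l2conj x)).
Proof.
apply: l2_ext => n; rewrite -!dot_delta.
rewrite -dotJ -JS [RHS]dot_l2conj l2conj_delta [in RHS]JS adjoint_delta.
by rewrite [dot (l2conj x) _]dot_l2conj conjcK l2conjK dotJ.
Qed.

Lemma ajac_sqr x : ajac (ajac x) = S (J x).
Proof. by rewrite adjointE. Qed.

(** Self-adjointness of an antilinear operator: the two vectors are exchanged
    without conjugation. *)
Lemma dot_ajac x y : dot (ajac x) y = dot (ajac y) x.
Proof.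
by rewrite dot_l2conj JS adjointE l2conjK dotJ.
Qed.

End AntilinearJacobi.

(** * Jacobi matrices and their orthogonal polynomials *)

Section JacobiMatrix.
Variables (R : realType) (J : bop R) (a : nat -> R) (b : nat -> R[i]).
Hypothesis hJ : has_matrix J (jacobi_mx a b).

Lemma jacobi_symmetric : symmetric_matrix J.
Proof.
move=> j k; rewrite !hJ /jacobi_mx eq_sym.
case: (eqVneq k j) => [-> //|_].
case: (eqVneq k j.+1) => [->|//].
by rewrite ltn_eqF.
Qed.

Lemma ajac_delta0 : ajac J (delta R 0) =
  (b 0%N)^*%C *: delta R 0 + (a 0%N)%:C *: delta R 1.
Proof.
apply: l2_ext => n; rewrite ajac_val hJ /jacobi_mx.
rewrite l2_valD !l2_valZ !delta_val.
case: n => [|[|n]]; rewrite ?mulr1 ?mulr0 ?addr0 ?add0r ?conjc0 //.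
by rewrite conjc_real.
Qed.

Lemma ajac_deltaS j : ajac J (delta R j.+1) = (a j)%:C *: delta R j
  + (b j.+1)^*%C *: delta R j.+1 + (a j.+1)%:C *: delta R j.+2.
Proof.
apply: l2_ext => n; rewrite ajac_val hJ /jacobi_mx.
rewrite !l2_valD !l2_valZ !delta_val.
case: (ltngtP n j.+1) => [nj|nj|->].
- rewrite eqSS [j == n]eq_sym (@ltn_eqF n j.+2) ?(ltn_trans nj) //.
  by case: (eqVneq n j) => [->|_]; rewrite ?mulr0 ?mulr1 !addr0 ?conjc_real ?conjc0.
- have jn : (j < n)%N := ltnW nj.
  rewrite eqSS (ltn_eqF jn) (gtn_eqF jn).
  rewrite !mulr0 !add0r.
  by case: (n == j.+2); rewrite ?mulr0 ?mulr1 ?conjc_real ?conjc0.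
- by rewrite gtn_eqF // ltn_eqF // !mulr0 add0r addr0 mulr1.
Qed.

End JacobiMatrix.

Section Krylov.
Variables (R : realType) (J : bop R).
Implicit Types p r : {poly R[i]}.

Definition krylov n : l2 R := iter n (ajac J) (delta R 0).

(** The coefficients are conjugated so that the antilinear operator acts on
    [krylov_eval p] as [p |-> s conj(p(s))], the right-hand side of the recurrence
    of the [q_j]; see [krylov_eval_mulX]. *)
Definition krylov_eval p : l2 R :=
  \sum_(n < size p) (p`_n)^*%C *: krylov n.

Lemma krylov_eval_wide p N : (size p <= N)%N ->
  krylov_eval p = \sum_(n < N) (p`_n)^*%C *: krylov n.
Proof.
move=> pN; rewrite /krylov_eval (big_ord_widen N (fun n => (p`_n)^*%C *: krylov n) pN).
rewrite big_mkcond; apply: eq_bigr => n _; case: ltnP => // np.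
by rewrite nth_default // conjc0 scale0r.
Qed.

Lemma krylov_evalZD c p r : krylov_eval (c *: p + r) =
  c^*%C *: krylov_eval p + krylov_eval r.
Proof.
pose N := maxn (size p) (size r).
rewrite !(@krylov_eval_wide _ N) ?leq_maxl ?leq_maxr //; last first.
  by rewrite (leq_trans (size_polyD _ _)) // geq_max leq_maxr andbT
    (leq_trans (size_scale_leq _ _)) // leq_maxl.
rewrite scaler_sumr -big_split; apply: eq_bigr => n _ /=.
by rewrite coefD coefZ conjcD conjcM scalerDl scalerA.
Qed.

Lemma krylov_evalD p r :
  krylov_eval (p + r) = krylov_eval p + krylov_eval r.
Proof. by rewrite -[p]scale1r krylov_evalZD conjc1 !scale1r. Qed.

Lemma krylov_eval0 : krylov_eval 0 = 0.
Proof. by rewrite /krylov_eval size_poly0 big_ord0. Qed.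

Lemma krylov_evalZ c p : krylov_eval (c *: p) = c^*%C *: krylov_eval p.
Proof. by rewrite -[c *: p]addr0 krylov_evalZD krylov_eval0 addr0. Qed.

Lemma krylov_eval1 : krylov_eval 1 = delta R 0.
Proof. by rewrite /krylov_eval size_poly1 big_ord1 coef1 conjc1 scale1r. Qed.

Lemma krylov_eval_mulX p :
  krylov_eval (map_poly conjc p * 'X) = ajac J (krylov_eval p).
Proof.
rewrite (@krylov_eval_wide _ (size p).+1); last first.
  by rewrite (leq_trans (size_polyMleq _ _)) // size_polyX addn2 /= ltnS
    size_poly.
rewrite big_ord_recl coefMX eqxx conjc0 scale0r add0r.
rewrite /krylov_eval (big_morph (ajac J) (ajacD J) (ajac0 J)).
by apply: eq_bigr => n _; rewrite ajacZ coefMX coef_map.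
Qed.

End Krylov.

Lemma horner_conj (R : realType) (p : {poly R[i]}) (s : R) :
  (p.[s%:C])^*%C = (map_poly conjc p).[s%:C].
Proof. by rewrite -[in RHS](conjc_real s); exact/esym/horner_map. Qed.

(** The recurrence of the [q_j] is given at real points only; infinitely many
    points are enough to turn it into an identity of polynomials. *)
Lemma poly_ext_real (R : realType) (p r : {poly R[i]}) :
  (forall s : R, p.[s%:C] = r.[s%:C]) -> p = r.
Proof.
move=> pr; apply/eqP; rewrite -subr_eq0; apply: contraT => nz.
pose s := [seq (n%:R : R)%:C | n <- iota 0 (size (p - r))].
suff : (size s < size (p - r)%R)%N by rewrite size_map size_iota ltnn.
apply: max_poly_roots nz _ _.
  apply/allP => _ /mapP[n _ ->].
  by rewrite /root hornerD hornerN pr subrr.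
rewrite map_inj_uniq ?iota_uniq // => m n /complexI /eqP.
by rewrite eqr_nat => /eqP.
Qed.

Section DeltaKrylov.
Variables (R : realType) (J : bop R) (a : nat -> R) (b : nat -> R[i]).
Hypothesis hJ : has_matrix J (jacobi_mx a b).
Hypothesis ha : forall j, 0 < a j.
Variable q : nat -> {poly R[i]}.
Hypothesis hq0 : q 0%N = 1.
Hypothesis hq1 : forall s : R,
  b 0%N * (q 0%N).[s%:C] + (a 0%N)%:C * (q 1%N).[s%:C]
    = s%:C * ((q 0%N).[s%:C])^*%C.
Hypothesis hq : forall (j : nat) (s : R),
  (a j)%:C * (q j).[s%:C] + b j.+1 * (q j.+1).[s%:C]
    + (a j.+1)%:C * (q j.+2).[s%:C] = s%:C * ((q j.+1).[s%:C])^*%C.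

Let a_inj j : injective (fun x : l2 R => (a j)%:C *: x).
Proof.
apply: (can_inj (g := fun x => (a j)%:C^-1 *: x)) => x.
rewrite scalerA mulVf ?scale1r //.
by apply/eqP => /complexI /eqP; rewrite gt_eqF.
Qed.

Let recq1 : b 0%N *: q 0%N + (a 0%N)%:C *: q 1%N = map_poly conjc (q 0%N) * 'X.
Proof.
apply: poly_ext_real => s.
by rewrite hornerD !hornerZ hq1 horner_conj hornerMX mulrC.
Qed.

Let recq j : (a j)%:C *: q j + b j.+1 *: q j.+1 + (a j.+1)%:C *: q j.+2 =
  map_poly conjc (q j.+1) * 'X.
Proof.
apply: poly_ext_real => s.
by rewrite !hornerD !hornerZ hq horner_conj hornerMX mulrC.
Qed.

(** Both sides satisfy the same three-term recurrence, which determines the next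
    term because its coefficient [a j] does not vanish. *)
Lemma krylov_eval_q j : krylov_eval J (q j) = delta R j.
Proof.
suff: krylov_eval J (q j) = delta R j /\ krylov_eval J (q j.+1) = delta R j.+1.
  by case.
elim: j => [|j [IH0 IH1]].
  have E0 : krylov_eval J (q 0%N) = delta R 0 by rewrite hq0 krylov_eval1.
  split=> //; apply: (@a_inj 0%N) => /=.
  have := congr1 (krylov_eval J) recq1.
  rewrite krylov_eval_mulX E0 (ajac_delta0 hJ) krylov_evalD !krylov_evalZ E0.
  by rewrite conjc_real => /addrI.
split=> //; apply: (@a_inj j.+1) => /=.
have := congr1 (krylov_eval J) (recq j).
rewrite krylov_eval_mulX IH1 (ajac_deltaS hJ) !krylov_evalD !krylov_evalZ.
by rewrite IH0 IH1 !conjc_real => /addrI.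
Qed.

End DeltaKrylov.

(** * Integrals against the spectral measure *)

Section SpectralMeasure.
Variables (R : realType) (A : bop R) (Phi : (R -> R[i]) -> bop R).
Hypothesis hPhi : borel_calculus A Phi.
Variable v : l2 R.
Variable nu : probability (measurableTypeR R) R.
Hypothesis hnu : forall D : set R, measurable D ->
  (fine (nu D))%:C = dot (Phi (cindic D) v) v.

Definition real_borel_lb (f : R -> R) : Prop :=
  measurable_fun [set: R] f /\
  forall r : R, exists M : R, forall s, `|s| <= r -> `|f s| <= M.

Lemma borel_lb_real f : real_borel_lb f -> borel_lb (fun s => (f s)%:C).
Proof.
move=> [mf bf]; split; first by split=> //=; exact: measurable_cst.
move=> r; have [M hM] := bf r; exists M => _ -> s sr.
by rewrite cabs_real hM.
Qed.

Lemma real_borel_lb_indic D : measurable D -> real_borel_lb \1_D.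
Proof.
move=> mD; split; first exact: measurable_indic.
move=> r; exists 1 => s _; rewrite indicE.
by case: (s \in D); rewrite ?normr1 ?normr0.
Qed.

Lemma real_borel_lb_cst c : real_borel_lb (fun=> c).
Proof. by split; [exact: measurable_cst|move=> r; exists `|c|]. Qed.

Lemma real_borel_lbD f g : real_borel_lb f -> real_borel_lb g ->
  real_borel_lb (fun s => f s + g s).
Proof.
move=> [mf bf] [mg bg]; split; first exact: measurable_funD.
move=> r; have [[M hM] [N hN]] := (bf r, bg r); exists (M + N) => s sr.
by rewrite (le_trans (ler_normD _ _)) // lerD ?hM ?hN.
Qed.

Lemma real_borel_lbM f g : real_borel_lb f -> real_borel_lb g ->
  real_borel_lb (fun s => f s * g s).
Proof.
move=> [mf bf] [mg bg]; split; first exact: measurable_funM.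
move=> r; have [[M hM] [N hN]] := (bf r, bg r); exists (M * N) => s sr.
by rewrite normrM ler_pM ?hM ?hN.
Qed.

Lemma real_borel_lb_id : real_borel_lb id.
Proof. by split; [exact: measurable_id|move=> r; exists r]. Qed.

Lemma real_borel_lbX f n : real_borel_lb f -> real_borel_lb (fun s => f s ^+ n).
Proof.
move=> bf; elim: n => [|n IH]; first exact: (real_borel_lb_cst 1).
under eq_fun do rewrite exprS.
exact: real_borel_lbM.
Qed.

Lemma real_borel_lb_norm f : real_borel_lb f -> real_borel_lb (fun s => `|f s|).
Proof.
move=> [mf bf]; split; first exact: measurableT_comp.
by move=> r; have [M hM] := bf r; exists M => s sr; rewrite normr_id hM.
Qed.

Lemma bc0 : Phi (fun=> 0) v = 0.
Proof.
have b0 := borel_lb_real (real_borel_lb_cst 0).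
have := bc_linear hPhi 1 v b0 b0.
under eq_fun do rewrite mul1r addr0.
by rewrite scale1r -{1}[Phi _ v]addr0 => /addrI.
Qed.

Lemma real_borel_lb_indic_sum (D : R -> set R) (r : seq R) :
  (forall y, measurable (D y)) ->
  real_borel_lb (fun s => \sum_(y <- r) y * \1_(D y) s).
Proof.
move=> mD; elim: r => [|y r IH].
  by under eq_fun do rewrite big_nil; exact: real_borel_lb_cst.
under eq_fun do rewrite big_cons.
apply: real_borel_lbD => //; apply: real_borel_lbM; first exact: real_borel_lb_cst.
exact: real_borel_lb_indic.
Qed.

Lemma dot_bc_indic_sum (D : R -> set R) (r : seq R) :
  (forall y, measurable (D y)) ->
  dot (Phi (fun s => (\sum_(y <- r) y * \1_(D y) s)%:C) v) v
    = (\sum_(y <- r) y * fine (nu (D y)))%:C.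
Proof.
move=> mD; elim: r => [|y r IH].
  rewrite big_nil; under eq_fun do rewrite big_nil.
  by rewrite bc0 dot0l.
rewrite big_cons rmorphD rmorphM /= -IH hnu // -dotZD; congr (dot _ v).
rewrite -(bc_linear hPhi).
- congr (Phi _ v); apply/funext => s.
  by rewrite big_cons rmorphD rmorphM.
- exact/borel_lb_real/real_borel_lb_indic.
- exact/borel_lb_real/real_borel_lb_indic_sum.
Qed.

Import HBNNSimple.

Lemma nnsfunE (h : {nnsfun measurableTypeR R >-> R}) :
  h = (fun s => \sum_(y <- fset_set (range h)) y * \1_(h @^-1` [set y]) s) :> (R -> R).
Proof.
by apply/funext => s; rewrite {1}[h s]fimfunE fsbig_finite.
Qed.

Lemma nnsfun_real_borel_lb (h : {nnsfun measurableTypeR R >-> R}) :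
  real_borel_lb h.
Proof.
rewrite [X in real_borel_lb X]nnsfunE; apply: real_borel_lb_indic_sum => y.
exact: (measurable_funPTI h).
Qed.

Lemma dot_bc_nnsfun (h : {nnsfun measurableTypeR R >-> R}) :
  exists2 m : R, (\int[nu]_s (h s)%:E = m%:E)%E &
    dot (Phi (fun s => (h s)%:C) v) v = m%:C.
Proof.
exists (\sum_(y <- fset_set (range h)) y * fine (nu (h @^-1` [set y]))).
  rewrite integral_nnsfun // patch_setT sintegralE fsbig_finite //= -sumEFin.
  by apply: eq_bigr => y _; rewrite EFinM fineK ?fin_num_measure.
rewrite -dot_bc_indic_sum => [|y]; last exact: (measurable_funPTI h).
by congr (dot (Phi _ v) v); apply/funext => s; rewrite [in LHS]nnsfunE.
Qed.

Lemma ccvg_real (r : nat -> R) (z : R[i]) : ccvg (fun n => (r n)%:C) z ->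
  r @ \oo --> complex.Re z /\ complex.Im z = 0.
Proof.
move=> rz; split.
  apply: cvg_sub0 (cvg_cst (complex.Re z)).
  apply: norm_cvg0.
  apply: squeeze_cvgr (cvg_cst 0) rz; apply: nearW => n /=.
  rewrite normr_ge0 (le_trans _ (normr_Re_le _)) //.
  by case: z.
apply/eqP; rewrite -normr_le0 -(cvg_lim _ rz) //.
apply: limr_ge; first exact: (cvgP 0).
apply: nearW => n; rewrite -normrN (le_trans _ (normr_Im_le _)) //.
by case: z {rz} => x y /=; rewrite sub0r.
Qed.

(** The simple functions [h n] increase to [f] and stay below it, so that they
    are bounded on bounded sets uniformly in [n]: both the monotone convergence
    theorem and the continuity of the Borel calculus apply. The integral is then
    finite because the matrix element of the Borel calculus is. *)
Lemma dot_bc_ge0 (f : R -> R) : real_borel_lb f -> (forall s, 0 <= f s) ->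
  exists2 m : R, (\int[nu]_s (f s)%:E = m%:E)%E &
    dot (Phi (fun s => (f s)%:C) v) v = m%:C.
Proof.
move=> bf f0; have [mf lf] := bf.
have mEf : measurable_fun [set: measurableTypeR R] (EFin \o f).
  exact/measurable_EFinP.
pose h := nnsfun_approx measurableT mEf.
have hf s : (h ^~ s) @ \oo --> f s.
  have Ef0 t : setT t -> (0 <= (EFin \o f) t)%E by rewrite lee_fin.
  exact: fine_cvg (cvg_nnsfun_approx measurableT mEf Ef0 (I : setT s)).
have ndh s : nondecreasing_seq (h ^~ s).
  by move=> m n mn; exact/lefP/nd_nnsfun_approx.
have hle n s : h n s <= f s.
  rewrite -(cvg_lim _ (hf s)) //.
  by apply: nondecreasing_cvgn_le => //; exact: cvgP (hf s).
have lim_int : (\int[nu]_s (h n s)%:E)%E @[n --> \oo] --> (\int[nu]_s (f s)%:E)%E.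
  have -> : (fun s => (f s)%:E) = (fun s => limn (fun n => (h n s)%:E)).
    apply/funext => s; apply/esym/cvg_lim => //.
    by apply: cvg_EFin (hf s); exact: nearW.
  apply: cvg_monotone_convergence => //.
  - by move=> n; exact/measurable_EFinP.
  - by move=> n s _; rewrite lee_fin.
  - by move=> s _ m n mn; rewrite lee_fin ndh.
have [m hm hPm] : exists2 m : nat -> R, forall n, (\int[nu]_s (h n s)%:E = (m n)%:E)%E &
    forall n, dot (Phi (fun s => (h n s)%:C) v) v = (m n)%:C.
  have /choice[m hm] : forall n, exists m : R, (\int[nu]_s (h n s)%:E = m%:E)%E /\
     dot (Phi (fun s => (h n s)%:C) v) v = m%:C.
    by move=> n; have [m ? ?] := dot_bc_nnsfun (h n); exists m.
  by exists m => n; have [] := hm n.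
set z := dot (Phi (fun s => (f s)%:C) v) v.
have /ccvg_real[mz z0] : ccvg (fun n => (m n)%:C) z.
  under eq_fun do rewrite -hPm.
  apply: (bc_cvg hPhi).
  - by move=> n; exact/borel_lb_real/nnsfun_real_borel_lb.
  - exact: borel_lb_real.
  - move=> r; have [M hM] := lf r; exists M => _ [n _ <-] s sr.
    rewrite cabs_real ger0_norm // (le_trans (hle n s)) //.
    by rewrite (le_trans _ (hM s sr)) // ler_norm.
  - move=> s; rewrite /ccvg.
    under eq_fun do rewrite -rmorphB cabs_real.
    exact/norm_cvg0P/subr_cvg0.
exists (complex.Re z).
  apply: (cvg_unique _ lim_int) => //.
  rewrite (_ : (fun n => _) = EFin \o m); last exact/funext.
  by apply: cvg_EFin mz; exact: nearW.
by apply: complex_eqP.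
Qed.

End SpectralMeasure.

(** * Support and moments of the spectral measure *)

Section Support.
Variables (R : realType) (A : bop R) (Phi : (R -> R[i]) -> bop R).
Hypothesis hPhi : borel_calculus A Phi.
Hypothesis hA : positive_op A.
Variable v : l2 R.
Variable nu : probability (measurableTypeR R) R.
Hypothesis hnu : forall D : set R, measurable D ->
  (fine (nu D))%:C = dot (Phi (cindic D) v) v.

(** Let [w] be the image of [v] under the spectral projection of the negative
    half-line. The integral of [- s] over this half-line is [- <A w, w>]: it is
    nonnegative by the sign of [s] and nonpositive by positivity of [A]. *)
Lemma spectral_measure_neg : nu `]-oo, 0[%classic = 0%E.
Proof.
set D := `]-oo, 0[%classic : set R.
have mD : measurable D by exact: measurable_itv.
have bD := real_borel_lb_indic mD.
have bid := @real_borel_lb_id R.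
have bN1 := real_borel_lb_cst (-1 : R).
pose f (s : R) := -1 * (\1_D s * (s * \1_D s)).
have bf : real_borel_lb f by do ![exact: real_borel_lb_indic | apply: real_borel_lbM].
have f0 s : 0 <= f s.
  rewrite /f indicE; case: (boolP (s \in D)) => sD; last by rewrite !mul0r mulr0.
  move: sD; rewrite inE /D /= in_itv /= => s0.
  by rewrite mul1r mulr1 mulN1r oppr_ge0 ltW.
have [m int_f dot_f] := dot_bc_ge0 hPhi hnu bf f0.
set w := Phi (cindic D) v.
have E : dot (Phi (fun s => (f s)%:C) v) v = - dot (A w) w.
  have bcD : borel_lb (cindic D) by exact: borel_lb_real.
  have bcid : borel_lb (fun s : R => s%:C) by exact: borel_lb_real.
  have -> : (fun s => (f s)%:C) =
      (fun s => (-1)%:C * (cindic D s * (s%:C * cindic D s)) + 0).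
    by apply/funext => s; rewrite addr0 /f !rmorphM.
  have bcDid : borel_lb (fun s : R => s%:C * cindic D s).
    have -> : (fun s : R => s%:C * cindic D s) = (fun s => (s * \1_D s)%:C).
      by apply/funext => s; rewrite rmorphM.
    by apply: borel_lb_real; exact: real_borel_lbM.
  have bcDD : borel_lb (fun s : R => cindic D s * (s%:C * cindic D s)).
    have -> : (fun s : R => cindic D s * (s%:C * cindic D s)) =
        (fun s => (\1_D s * (s * \1_D s))%:C).
      by apply/funext => s; rewrite !rmorphM.
    by apply: borel_lb_real; do 2 apply: real_borel_lbM => //.
  rewrite (bc_linear hPhi) //; last exact: (borel_lb_real (real_borel_lb_cst 0)).
  rewrite (bc0 hPhi) addr0 dotZl rmorphN rmorph1 mulN1r; congr (- _).
  rewrite (bc_mul hPhi) // (bc_mul hPhi) // (bc_id hPhi) (bc_conj hPhi) //.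
  congr (dot _ (Phi _ v)); apply/funext => s.
  by rewrite /cindic conjc_real.
have m0 : m = 0.
  apply/eqP; rewrite eq_le; apply/andP; split.
    by rewrite -lecR -dot_f E oppr_le0; exact: hA.
  by rewrite -lee_fin -int_f; apply: integral_ge0 => s _; rewrite lee_fin.
have mEf : measurable_fun [set: measurableTypeR R] (EFin \o f).
  by apply/measurable_EFinP; have [] := bf.
have : (\int[nu]_s `|(EFin \o f) s| = 0)%E.
  rewrite -[RHS](congr1 EFin m0) -int_f; apply: eq_integral => s _.
  by rewrite /= ger0_norm.
move=> /(ae_eq_integral_abs _ measurableT mEf).1 aef.
apply: measure_negligible => //; apply: negligibleS aef => s Ds /=.
move=> /(_ I) [] /eqP.
have sD : s \in D by rewrite inE.
rewrite /f indicE sD mul1r mulr1 mulN1r oppr_eq0.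
by move: Ds; rewrite /D /= in_itv /= => s0; rewrite lt_eqF.
Qed.

Lemma bc_pow n x : Phi (fun s => s%:C ^+ n) x = iter n A x.
Proof.
elim: n => [|n IH] /=; first exact: (bc_one hPhi).
rewrite -IH -(bc_id hPhi) -(bc_mul hPhi); last 2 first.
- exact: (borel_lb_real (@real_borel_lb_id R)).
- have -> : (fun s : R => s%:C ^+ n) = (fun s => (s ^+ n)%:C).
    by apply/funext => s; rewrite rmorphXn.
  exact/borel_lb_real/real_borel_lbX/real_borel_lb_id.
by congr (Phi _ x); apply/funext => s; rewrite exprS.
Qed.

Local Notation half_line := (`[0, +oo[%classic : set (measurableTypeR R)).

Lemma integrable_pow n :
  nu.-integrable half_line (EFin \o (fun s : R => s ^+ n)).
Proof.
have bX := real_borel_lbX n (@real_borel_lb_id R).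
apply: (@integrableS _ _ _ _ setT) => //.
apply/integrableP; split; first by apply/measurable_EFinP; have [] := bX.
have [m /= -> _] := dot_bc_ge0 hPhi hnu (real_borel_lb_norm bX) (fun s => normr_ge0 _).
exact: ltry.
Qed.

Lemma even_moment n : ~~ odd n ->
  (\int[nu]_(s in half_line) (s ^+ n)%:E)%E =
     (complex.Re (dot (iter n A v) v))%:E /\
  complex.Im (dot (iter n A v) v) = 0.
Proof.
move=> en; have bX := real_borel_lbX n (@real_borel_lb_id R).
have [m int_m] := dot_bc_ge0 hPhi hnu bX (fun s => exprn_even_ge0 s en).
under eq_fun do rewrite rmorphXn.
rewrite bc_pow => ->; split=> //=; rewrite -int_m.
rewrite [RHS](ge0_negligible_integral _ _ _ _ spectral_measure_neg) //.
- rewrite setTD; congr integral.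
  by rewrite setCitvl.
- by apply/measurable_EFinP; have [] := bX.
- by move=> s _; rewrite lee_fin exprn_even_ge0.
Qed.

End Support.

(** * Complex-valued integrals *)

Section ComplexIntegral.
Variables (R : realType) (mu : {measure set (measurableTypeR R) -> \bar R}).
Variables (D : set (measurableTypeR R)) (mD : measurable D).
Implicit Types f g : R -> R[i].

Definition cintegrable f : Prop :=
  mu.-integrable D (EFin \o (fun s => complex.Re (f s))) /\
  mu.-integrable D (EFin \o (fun s => complex.Im (f s))).

Let integrableL (c d : R) (u w : R -> R) :
  mu.-integrable D (EFin \o u) -> mu.-integrable D (EFin \o w) ->
  mu.-integrable D (EFin \o (fun s => c * u s + d * w s)).
Proof.
move=> iu iw; apply: (integrableD mD (f := EFin \o (fun s => c * u s))
  (g := EFin \o (fun s => d * w s))).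
  exact: (integrableZl mD c iu).
exact: (integrableZl mD d iw).
Qed.

Let RintegralL (c d : R) (u w : R -> R) :
  mu.-integrable D (EFin \o u) -> mu.-integrable D (EFin \o w) ->
  Rintegral mu D (fun s => c * u s + d * w s) =
  c * Rintegral mu D u + d * Rintegral mu D w.
Proof.
move=> iu iw; rewrite RintegralD //; last 2 first.
- exact: (integrableZl mD c iu).
- exact: (integrableZl mD d iw).
by rewrite !RintegralZl.
Qed.

Lemma cintegrableZ c f : cintegrable f -> cintegrable (fun s => c * f s).
Proof.
move=> [fR fI]; split.
  under eq_fun do rewrite cReM -mulNr.
  exact: integrableL.
under eq_fun do rewrite cImM.
exact: integrableL.
Qed.

Lemma cintegrableD f g : cintegrable f -> cintegrable g ->
  cintegrable (fun s => f s + g s).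
Proof.
move=> [fR fI] [gR gI]; split.
  under eq_fun do rewrite cReD.
  exact: (integrableD mD fR gR).
under eq_fun do rewrite cImD.
exact: (integrableD mD fI gI).
Qed.

Lemma cintegralZ c f : cintegrable f ->
  cintegral mu D (fun s => c * f s) = c * cintegral mu D f.
Proof.
move=> [fR fI]; apply: complex_eqP; rewrite ?cReM ?cImM /=.
  under eq_fun do rewrite cReM -mulNr.
  by rewrite RintegralL // mulNr.
under eq_fun do rewrite cImM.
by rewrite RintegralL.
Qed.

Lemma cintegralD f g : cintegrable f -> cintegrable g ->
  cintegral mu D (fun s => f s + g s) = cintegral mu D f + cintegral mu D g.
Proof.
move=> [fR fI] [gR gI]; apply: complex_eqP; rewrite ?cReD ?cImD /=.
  by under eq_fun do rewrite cReD; rewrite RintegralD.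
by under eq_fun do rewrite cImD; rewrite RintegralD.
Qed.

Lemma cintegral_conj f : cintegrable f ->
  cintegral mu D (fun s => (f s)^*%C) = (cintegral mu D f)^*%C.
Proof.
move=> [fR fI]; apply: complex_eqP; rewrite ?cReJ ?cImJ /=.
  by under eq_fun do rewrite cReJ.
under eq_fun do rewrite cImJ -mulN1r.
by rewrite RintegralZl // mulN1r.
Qed.

Lemma cintegral0 : cintegral mu D (fun=> 0) = 0.
Proof.
by rewrite /cintegral /Rintegral /= integral0.
Qed.

Lemma cintegrable0 : cintegrable (fun=> 0).
Proof. by split; exact: integrable0. Qed.

Lemma cintegrable_sum I (r : seq I) (F : I -> R -> R[i]) :
  (forall i, cintegrable (F i)) ->
  cintegrable (fun s => \sum_(i <- r) F i s).
Proof.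
move=> iF; elim: r => [|i r IH].
  by under eq_fun do rewrite big_nil; exact: cintegrable0.
by under eq_fun do rewrite big_cons; exact: cintegrableD.
Qed.

Lemma cintegral_sum I (r : seq I) (F : I -> R -> R[i]) :
  (forall i, cintegrable (F i)) ->
  cintegral mu D (fun s => \sum_(i <- r) F i s) =
  \sum_(i <- r) cintegral mu D (F i).
Proof.
move=> iF; elim: r => [|i r IH].
  by under eq_fun do rewrite big_nil; rewrite big_nil cintegral0.
under eq_fun do rewrite big_cons.
by rewrite cintegralD // ?IH ?big_cons //; exact: cintegrable_sum.
Qed.

Lemma cintegrable_dominated (f : R -> R[i]) (g : R -> R) :
  cmeasurable D f -> mu.-integrable D (EFin \o g) ->
  {ae mu, forall s, D s -> cabs (f s) <= `|g s|} -> cintegrable f.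
Proof.
move=> [mR mI] ig fg.
have dominated (u : R -> R) : measurable_fun D u ->
    (forall s, `|u s| <= cabs (f s)) -> mu.-integrable D (EFin \o u).
  move=> mu_ uf; apply/integrableP; split; first exact/measurable_EFinP.
  have /integrableP[mg fin_g] := ig.
  apply: le_lt_trans fin_g; apply: ae_ge0_le_integral => //.
  - exact/measurableT_comp/measurable_EFinP.
  - exact: measurableT_comp.
  - apply: filterS fg => s fgs Ds; rewrite lee_fin (le_trans (uf s)) //.
    exact: fgs.
split; apply: dominated => // s; [exact: normr_Re_le|exact: normr_Im_le].
Qed.

End ComplexIntegral.

(** * The two matrix weights *)

Lemma conjc_realX (R : realType) (s : R) n :
  ((s%:C : R[i]) ^+ n)^*%C = s%:C ^+ n.
Proof. by rewrite -rmorphXn conjc_real. Qed.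

Lemma even_partE (R : realType) (p : {poly R[i]}) (s : R) :
  even_part p s = \sum_(n < size p) (~~ odd n)%:R * (p`_n * s%:C ^+ n).
Proof.
rewrite /even_part !horner_coef -big_split mulr_suml; apply: eq_bigr => n _ /=.
rewrite rmorphN exprNn -signr_odd; case: (odd n); rewrite /= ?expr1 ?expr0.
  by rewrite !mulN1r mulrN subrr !mul0r.
by rewrite !mul1r -mulr2n -[_ *+ 2]mulr_natr mulfK // pnatr_eq0.
Qed.

Lemma odd_partE (R : realType) (p : {poly R[i]}) (s : R) :
  odd_part p s = \sum_(n < size p) (odd n)%:R * (p`_n * s%:C ^+ n).
Proof.
rewrite /odd_part !horner_coef -sumrB mulr_suml; apply: eq_bigr => n _ /=.
rewrite rmorphN exprNn -signr_odd; case: (odd n); rewrite /= ?expr1 ?expr0.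
  by rewrite !mulN1r mulrN opprK mul1r -mulr2n -[_ *+ 2]mulr_natr mulfK ?pnatr_eq0.
by rewrite !mul1r subrr !mul0r.
Qed.

Section DotForms.
Variable R : realType.
Implicit Types (p r : {poly R[i]}) (z : R[i]).

Lemma dot2_cmx2 (m00 m01 m10 m11 x0 x1 y0 y1 : R[i]) :
  dot2 (cmx2 m00 m01 m10 m11 *m cvec2 x0 x1) (cvec2 y0 y1) =
  (m00 * x0 + m01 * x1) * y0^*%C + (m10 * x0 + m11 * x1) * y1^*%C.
Proof.
rewrite /dot2 !big_ord_recl !big_ord0 !mxE.
by rewrite !big_ord_recl !big_ord0 !mxE /= !addr0.
Qed.

Lemma horner_even_odd p (s : R) : p.[s%:C] = even_part p s + odd_part p s.
Proof. by rewrite /even_part /odd_part; field. Qed.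

Lemma hornerN_even_odd p (s : R) :
  p.[(- s)%:C] = even_part p s - odd_part p s.
Proof. by rewrite /even_part /odd_part; field. Qed.

(** The change of basis [(q(s), q(-s)) = (e + o, e - o)] turns one quadratic
    form into twice the other. *)
Lemma dot2_even_odd p r z (s : R) :
  dot2 (cmx2 (1 + (complex.Re z)%:C) (- ('i%C * (complex.Im z)%:C))
          ('i%C * (complex.Im z)%:C) (1 - (complex.Re z)%:C)
         *m cvec2 p.[s%:C] p.[(- s)%:C]) (cvec2 r.[s%:C] r.[(- s)%:C])
  = 2 * dot2 (cmx2 1 z z^*%C 1 *m cvec2 (even_part p s) (odd_part p s))
          (cvec2 (even_part r s) (odd_part r s)).
Proof.
rewrite !dot2_cmx2 !hornerN_even_odd !(horner_even_odd _ s).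
have zE := complexE z.
have zJ : z^*%C = (complex.Re z)%:C - 'i%C * (complex.Im z)%:C.
  by apply: complex_eqP; case: z {zE} => x y /=; simpc.
have conjcB (u w : R[i]) : (u - w)^*%C = u^*%C - w^*%C by exact: rmorphB.
rewrite zJ conjcD conjcB.
move: (complex.Re z)%:C ('i%C * (complex.Im z)%:C) zE {zJ} => x y ->.
ring.
Qed.

End DotForms.

(** * Orthogonality *)

Section Orthogonality.
Variables (R : realType) (J A S : bop R) (Phi : (R -> R[i]) -> bop R).
Variables (nu : probability (measurableTypeR R) R) (psi : R -> R[i]).
Hypothesis Jsym : symmetric_matrix J.
Hypothesis JS : is_adjoint J S.
Hypothesis AA : forall x, A (A x) = S (J x).
Hypothesis hA : positive_op A.
Hypothesis hPhi : borel_calculus A Phi.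
Hypothesis hnu : forall D : set R, measurable D ->
  (fine (nu D))%:C = dot (Phi (cindic D) (delta R 0)) (delta R 0).
Local Notation half_line := (`[0, +oo[%classic : set (measurableTypeR R)).
Hypothesis mpsi : cmeasurable half_line psi.
Hypothesis psi_le1 : {ae nu, forall s, 0 <= s -> cabs (psi s) <= 1}.
Hypothesis hpsi : forall f, ccontinuous f ->
  dot (J (Phi f (delta R 0))) (delta R 0) =
    cintegral nu half_line (fun s => s%:C * f s * psi s).

Local Notation e := (krylov J).

Lemma dot_krylovS m n : dot (e m) (e n.+1) = (dot (e m.+1) (e n))^*%C.
Proof.
have -> : dot (e m.+1) (e n) = dot (e n.+1) (e m) by exact: dot_ajac Jsym _ JS _ _.
by rewrite dotJ.
Qed.

(** Each exchange of a factor [T] between the two sides costs a conjugation, and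
    two of them cancel. *)
Lemma dot_krylov m n : dot (e m) (e n) =
  if odd n then (dot (e (n + m)) (delta R 0))^*%C else dot (e (n + m)) (delta R 0).
Proof.
elim: n m => [|n IH] m //; rewrite dot_krylovS IH addnS addSn oddS.
by case: (odd n); rewrite ?conjcK.
Qed.

Lemma krylov_even n : ~~ odd n -> e n = iter n A (delta R 0).
Proof.
move=> en; rewrite -(even_halfK en); elim: (n./2) => // k IH.
by rewrite doubleS iterS iterS -IH AA -(ajac_sqr Jsym JS).
Qed.

Lemma ccontinuous_pow n : ccontinuous (fun s : R => s%:C ^+ n).
Proof.
have -> : (fun s : R => s%:C ^+ n) = (fun s => (s ^+ n)%:C).
  by apply/funext => s; rewrite rmorphXn.
by split=> s /=; [exact: exprn_continuous|exact: cst_continuous].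
Qed.

Lemma even_krylov_moment n : ~~ odd n ->
  dot (e n) (delta R 0) = cintegral nu half_line (fun s => s%:C ^+ n * 1).
Proof.
move=> en; have [int_n dot_n] := even_moment hPhi hA hnu en.
rewrite krylov_even //.
have -> : (fun s : R => s%:C ^+ n * 1) = (fun s => (s ^+ n)%:C).
  by apply/funext => s; rewrite mulr1 rmorphXn.
apply: complex_eqP; first by rewrite /= /Rintegral int_n.
by rewrite dot_n /= /Rintegral integral0.
Qed.

(** Here [T^n = C J |J|^(n-1)]; the exponent [n - 1] is even, hence
    [|J|^(n-1) delta_0] is also a vector [T^(n-1) delta_0]. *)
Lemma odd_krylov_moment n : odd n ->
  dot (e n) (delta R 0) = (cintegral nu half_line (fun s => s%:C ^+ n * psi s))^*%C.
Proof.
case: n => // n en.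
rewrite /= dot_l2conj l2conj_delta -/(e n) krylov_even // -(bc_pow hPhi).
rewrite hpsi; last exact: ccontinuous_pow.
by congr ((cintegral _ _ _)^*)%C; apply/funext => s; rewrite exprS.
Qed.

(** The entry of the matrix [(1, psi; conj psi, 1)] that pairs a monomial of
    degree [n] with the conjugate of a monomial of degree [m], the two rows and
    columns being indexed by parity. *)
Definition weight (n m : nat) (s : R) : R[i] :=
  if odd n == odd m then 1 else if odd n then psi s else (psi s)^*%C.

Lemma cmeasurableJ (D : set R) (w : R -> R[i]) :
  cmeasurable D w -> cmeasurable D (fun s => (w s)^*%C).
Proof.
move=> [mR mI]; split; first by under eq_fun do rewrite cReJ.
by under eq_fun do rewrite cImJ; exact: measurableT_comp.
Qed.

Lemma cintegrable_powM n (w : R -> R[i]) : cmeasurable half_line w ->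
  {ae nu, forall s, 0 <= s -> cabs (w s) <= 1} ->
  cintegrable nu half_line (fun s => s%:C ^+ n * w s).
Proof.
move=> [mR mI] w1.
apply: (cintegrable_dominated _ _ (integrable_pow hPhi hnu n)).
- exact: measurable_itv.
- have reE s : complex.Re (s%:C ^+ n * w s) = s ^+ n * complex.Re (w s).
    by rewrite -rmorphXn cReM /= mul0r subr0.
  have imE s : complex.Im (s%:C ^+ n * w s) = s ^+ n * complex.Im (w s).
    by rewrite -rmorphXn cImM /= mul0r addr0.
  split; [rewrite (funext reE)|rewrite (funext imE)];
    by apply: measurable_funM => //; exact: exprn_measurable.
- apply: negligibleS w1; apply: subsetC => s ws; rewrite /= in_itv /= andbT => s0.
  rewrite -rmorphXn ComplexField.Normc.normcM cabs_real.
  by rewrite ler_piMr // ws.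
Qed.

Lemma cintegrable_weight n m k :
  cintegrable nu half_line (fun s => s%:C ^+ k * weight n m s).
Proof.
rewrite /weight; case: (odd n == odd m); last case: (odd n);
  apply: cintegrable_powM.
- by split; exact: measurable_cst.
- apply: aeW => s _; by rewrite cabs_real normr1.
- exact: mpsi.
- exact: psi_le1.
- exact: cmeasurableJ.
- by apply: negligibleS psi_le1; apply: subsetC => s h s0; rewrite cabsJ h.
Qed.

Lemma cintegral_weight n m :
  cintegral nu half_line (fun s => s%:C ^+ (n + m) * weight n m s)
    = dot (e m) (e n).
Proof.
have ipsi k : cintegrable nu half_line (fun s => s%:C ^+ k * psi s).
  exact: cintegrable_powM.
rewrite dot_krylov /weight; case: (eqVneq (odd n) (odd m)) => nm.
  have enm : ~~ odd (n + m) by rewrite oddD nm addbb.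
  rewrite even_krylov_moment //; case: (odd n) => //.
  rewrite -cintegral_conj.
  - congr cintegral; apply/funext => s.
    by rewrite mulr1 conjc_realX.
  - exact: measurable_itv.
  - have := cintegrable_weight 0 0 (n + m); exact.
have onm : odd (n + m) by rewrite oddD; case: (odd n) (odd m) nm => [] [].
rewrite odd_krylov_moment // conjcK; case: (odd n) => //.
rewrite -cintegral_conj //.
congr cintegral; apply/funext => s.
by rewrite conjcM conjc_realX.
Qed.

(** Expanding both polynomials, the coefficient of [p`_n conj(r`_m)] on the left
    is [cintegral_weight], and on the right it is the inner product of
    [T^m delta_0] and [T^n delta_0]. Integrability is recorded with the value
    because it is needed to multiply the integral by a constant. *)
Lemma cintegral_even_odd (p r : {poly R[i]}) :
  cintegrable nu half_line (fun s => dot2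
    (cmx2 1 (psi s) (psi s)^*%C 1 *m cvec2 (even_part p s) (odd_part p s))
    (cvec2 (even_part r s) (odd_part r s))) /\
  cintegral nu half_line (fun s => dot2
    (cmx2 1 (psi s) (psi s)^*%C 1 *m cvec2 (even_part p s) (odd_part p s))
    (cvec2 (even_part r s) (odd_part r s)))
  = dot (krylov_eval J r) (krylov_eval J p).
Proof.
have mH : measurable half_line by exact: measurable_itv.
have -> : (fun s => dot2
    (cmx2 1 (psi s) (psi s)^*%C 1 *m cvec2 (even_part p s) (odd_part p s))
    (cvec2 (even_part r s) (odd_part r s))) =
  (fun s => \sum_(n < size p) \sum_(m < size r)
     (p`_n * (r`_m)^*%C) * (s%:C ^+ (n + m) * weight n m s)).
  apply/funext => s; rewrite dot2_cmx2 !mul1r !even_partE !odd_partE.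
  rewrite !(big_morph (@conjc R) (@conjcD R) (@conjc0 R)).
  (* parity indicators select one of the four products for each [(n, m)] *)
  rewrite [psi s * _]mulr_sumr [(psi s)^*%C * _]mulr_sumr.
  rewrite -!big_split !big_distrlr -big_split /=.
  apply: eq_bigr => n _; rewrite -big_split; apply: eq_bigr => m _ /=.
  rewrite !conjcM !conjc_nat conjc_realX exprD /weight.
  by case: (odd n); case: (odd m) => /=; ring.
have icoef n m c : cintegrable nu half_line
    (fun s => c * (s%:C ^+ (n + m) * weight n m s)).
  by apply: cintegrableZ => //; exact: cintegrable_weight.
split.
  by do 2 apply: cintegrable_sum => // ?.
rewrite cintegral_sum // => [|n]; last exact: cintegrable_sum.
rewrite /krylov_eval dot_sumr; apply: eq_bigr => n _.
rewrite cintegral_sum // dot_suml; apply: eq_bigr => m _.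
rewrite cintegralZ //; last exact: cintegrable_weight.
by rewrite cintegral_weight dotZl dotZr conjcK; ring.
Qed.

End Orthogonality.

Theorem theorem2p8 (R : realType) (a : nat -> R) (b : nat -> R[i]) (J : bop R)
    (nu : probability (measurableTypeR R) R) (psi : R -> R[i])
    (q : nat -> {poly R[i]})
    (ha : forall j, 0 < a j)
    (hab : jacobi_bounded a b)
    (hJ : has_matrix J (jacobi_mx a b))
    (hdata : spectral_data J nu psi)
    (hq0 : q 0%N = 1)
    (hq1 : forall s : R,
      b 0%N * (q 0%N).[s%:C] + (a 0%N)%:C * (q 1%N).[s%:C] = s%:C * ((q 0%N).[s%:C])^*%C)
    (hq : forall (j : nat) (s : R),
      (a j)%:C * (q j).[s%:C] + b j.+1 * (q j.+1).[s%:C]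
        + (a j.+1)%:C * (q j.+2).[s%:C] = s%:C * ((q j.+1).[s%:C])^*%C) :
  (forall j k : nat,
    1 / 2 * cintegral nu `[0, +oo[
      (fun s => dot2
        (cmx2 (1 + (complex.Re (psi s))%:C) (- ('i%C * (complex.Im (psi s))%:C))
              ('i%C * (complex.Im (psi s))%:C) (1 - (complex.Re (psi s))%:C)
         *m cvec2 (q j).[s%:C] (q j).[(- s)%:C])
        (cvec2 (q k).[s%:C] (q k).[(- s)%:C]))
    = (j == k)%:R)
  /\
  (forall j k : nat,
    cintegral nu `[0, +oo[
      (fun s => dot2
        (cmx2 1 (psi s) (psi s)^*%C 1
         *m cvec2 (even_part (q j) s) (odd_part (q j) s))
        (cvec2 (even_part (q k) s) (odd_part (q k) s)))
    = (j == k)%:R).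
Proof.
have [A [Phi [[hA [S JS AA]] hPhi hnu [mpsi _ psi1] hpsi]]] := hdata.
have ortho := cintegral_even_odd (jacobi_symmetric hJ) JS AA hA hPhi hnu
  mpsi psi1 hpsi.
have dot_q j k : dot (krylov_eval J (q k)) (krylov_eval J (q j)) = (j == k)%:R.
  by rewrite !(krylov_eval_q hJ ha hq0 hq1 hq) dot_delta delta_val.
split=> j k; have [int_q int_qE] := ortho (q j) (q k); last by rewrite int_qE.
rewrite (funext (fun s => dot2_even_odd (q j) (q k) (psi s) s)).
by rewrite cintegralZ // int_qE dot_q div1r mulrA mulVf ?mul1r // pnatr_eq0.
Qed.
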